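(* Let $p$ be a prime, $k\ge 1$ an integer, $\xi$ a nonconstant random variable valued in $\mathbb{F}_p$, and $r_1,\dots,r_k\in\mathbb{Z}_{\ge 0}$. For each $n$ let $M_1,\dots,M_k$ be independent random elements of $\mathrm{Mat}_n(\mathbb{F}_p)$ with entries iid copies of $\xi$. Then $$\lim_{n\to\infty}\mathbf{P}\big(\mathrm{rank}(M_1\cdots M_i)=n-(r_1+\cdots+r_i)\text{ for all }1\le i\le k\big)=(p^{-1};p^{-1})_\infty^k\prod_{i=1}^k\frac{p^{-r_i(r_i+\cdots+r_1)}}{(p^{-1};p^{-1})_{r_i}\,(p^{-1};p^{-1})_{r_i+\cdots+r_1}}.$$
   Context: $q$-Pochhammer symbols: $(a;q)_n:=\prod_{i=0}^{n-1}(1-aq^i)$ and $(a;q)_\infty:=\prod_{i\ge 0}(1-aq^i)$. *)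

(* Defs.v *)
From HB Require Import structures.
From mathcomp Require Import all_boot all_order all_algebra.
From mathcomp Require Import all_classical all_reals all_analysis.

Set Implicit Arguments.
Unset Strict Implicit.
Unset Printing Implicit Defensive.

Import Order.TTheory GRing.Theory Num.Theory.
Import numFieldNormedType.Exports.

Local Open Scope classical_set_scope.
Local Open Scope ring_scope.

(* [discrete V] is [V] with the power-set sigma-algebra. It is an alias so that
   the instance does not interfere with other measurable structures on [V]. It
   is restricted to [zmodType]s because a [measurableType] must be pointed. *)
Definition discrete (V : Type) : Type := V.

Section discrete_instances.
Variable V : zmodType.

HB.instance Definition _ := Choice.copy (discrete V) V.
HB.instance Definition _ := isPointed.Build (discrete V) (0 : V).
HB.instance Definition _ := @isMeasurable.Build default_measure_display
  (discrete V) (@discrete_measurable V) (@discrete_measurable0 V)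
  (@discrete_measurableC V) (@discrete_measurableU V).

End discrete_instances.

Definition mutually_independent (R : realType) (d : measure_display)
    (T : measurableType d) (P : probability T R) (I : finType)
    (d' : measure_display) (T' : measurableType d') (X : I -> T -> T') : Prop :=
  forall (J : {set I}) (A : I -> set T'),
    (forall i, i \in J -> measurable (A i)) ->
    P (\bigcap_(i in [set` J]) (X i @^-1` A i)) =
    (\prod_(i in J) P (X i @^-1` A i))%E.

Definition qpochhammer (R : realType) (a q : R) (n : nat) : R :=
  \prod_(i < n) (1 - a * q ^+ i).

(* Only meaningful when the partial products converge, e.g. for [`|q| < 1]. *)
Definition qpochhammer_inf (R : realType) (a q : R) : R :=
  limn (qpochhammer a q).

Definition partial_sum (k : nat) (r : 'I_k -> nat) (i : 'I_k) : nat :=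
  (\sum_(j < k | (j <= i)%N) r j)%N.

(* The noncommutative product is taken in increasing order of the index, since
   that is how ['I_k] is enumerated. *)
Definition partial_prod (F : fieldType) (n k : nat) (M : 'I_k -> 'M[F]_n)
    (i : 'I_k) : 'M[F]_n :=
  \prod_(j < k | (j <= i)%N) M j.

(* Main.v *)
Require Import Defs.
From mathcomp Require Import all_boot all_order all_algebra mxabelem.
From mathcomp Require Import all_classical all_reals all_analysis.
From mathcomp Require Import ring lra zify.

Set Implicit Arguments.
Unset Strict Implicit.
Unset Printing Implicit Defensive.

Import Order.TTheory GRing.Theory Num.Theory.
Import numFieldNormedType.Exports.

Local Open Scope classical_set_scope.
Local Open Scope ring_scope.

(** Condition on [A = M_1 ... M_(i-1)], of corank [s], and reveal the rows of
    the transpose of [M_i] one at a time. The codimension [c] in the row space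
    of [A^T] of the span of the images of the first [t] rows drops by one unless
    the next row lies in a subspace of codimension [c]. A nonzero vector
    orthogonal to that subspace kills the rows already revealed, hence, when [t]
    is close to [n], has large Hamming weight with high probability; an L^2
    contraction estimate for linear forms in copies of [xi] then makes the next
    row stay in the subspace with probability close to [p^-c]. On the other
    hand, the first [n - L] rows have independent images up to an error that is
    geometric in [L], since a subspace of codimension [c] has probability at most
    [rho^c], where [rho < 1] is the largest atom of [xi]. Hence the law of the
    corank of [A M_i] is close to the law of an explicit Markov chain run for [L]
    steps, uniformly in [A]; solving the chain, letting [n] and then [L] tend to
    infinity, and multiplying over [i] gives the limit. *)

(** * Weighted sums over matrices *)

Section WeightedSums.
Variables (R : realFieldType) (F : finFieldType) (g : F -> R).

(** The probability of [Y] under independent entries of law [g], and [wsum] is the expectation.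
    Neither positivity nor total mass one is built in, so the same sums also serve as generating
    functions. *)
Definition mxweight a b (Y : 'M[F]_(a, b)) : R := \prod_i \prod_j g (Y i j).

Definition wsum a b (G : 'M[F]_(a, b) -> R) : R := \sum_Y mxweight Y * G Y.

Lemma mxweight_tr a b (Y : 'M[F]_(a, b)) : mxweight Y^T = mxweight Y.
Proof.
rewrite /mxweight exchange_big /=.
by apply: eq_bigr => i _; apply: eq_bigr => j _; rewrite mxE.
Qed.

Lemma eq_wsum a b (G H : 'M[F]_(a, b) -> R) : G =1 H -> wsum G = wsum H.
Proof. by move=> GH; apply: eq_bigr => Y _; rewrite GH. Qed.

Lemma wsum_tr a b (G : 'M[F]_(a, b) -> R) : wsum (fun Y => G Y^T) = wsum G.
Proof.
rewrite /wsum [RHS](reindex (@trmx F b a)) /=.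
  by apply: eq_bigr => Y _; rewrite mxweight_tr.
by exists trmx => Y _; rewrite trmxK.
Qed.

Lemma wsum_col_mx a1 a2 b (G : 'M[F]_(a1 + a2, b) -> R) :
  wsum G = wsum (fun y : 'M[F]_(a1, b) => wsum (fun Y : 'M[F]_(a2, b) => G (col_mx y Y))).
Proof.
rewrite /wsum; under [RHS]eq_bigr do rewrite mulr_sumr.
rewrite pair_big /= (reindex (fun u : 'M[F]_(a1, b) * 'M[F]_(a2, b) => col_mx u.1 u.2)) /=.
  apply: eq_bigr => -[y Y] _ /=; rewrite mulrA; congr (_ * _).
  rewrite /mxweight big_split_ord /=.
  by congr (_ * _); apply: eq_bigr => i _; apply: eq_bigr => j _;
    rewrite (col_mxEu, col_mxEd).
exists (fun Y => (usubmx Y, dsubmx Y)) => [[y Y]|Y] _ /=.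
  by rewrite col_mxKu col_mxKd.
by rewrite vsubmxK.
Qed.

Lemma wsum_row_mx a b1 b2 (G : 'M[F]_(a, b1 + b2) -> R) :
  wsum G = wsum (fun y : 'M[F]_(a, b1) => wsum (fun Y : 'M[F]_(a, b2) => G (row_mx y Y))).
Proof.
rewrite -wsum_tr wsum_col_mx -wsum_tr; apply: eq_wsum => y.
by rewrite -wsum_tr; apply: eq_wsum => Y; rewrite tr_col_mx !trmxK.
Qed.

Lemma wsum11 (G : 'M[F]_1 -> R) : wsum G = \sum_c g c * G c%:M.
Proof.
rewrite /wsum (reindex (fun c : F => c%:M)) /=.
  by apply: eq_bigr => c _; rewrite /mxweight !big_ord1 mxE eqxx.
exists (fun Y : 'M[F]_1 => Y 0 0) => [c|Y] _; first by rewrite mxE eqxx.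
by rewrite -mx11_scalar.
Qed.

Lemma wsum1 a b : wsum (fun _ : 'M[F]_(a, b) => 1) = (\sum_c g c) ^+ (a * b).
Proof.
have row1 n : wsum (fun _ : 'rV[F]_n => 1) = (\sum_c g c) ^+ n.
  elim: n => [|n IH].
    rewrite /wsum (eq_bigr (fun=> 1)) => [|Y _]; last first.
      by rewrite /mxweight big_ord1 big_ord0 mul1r.
    by rewrite big_const iter_addr addr0 card_mx muln0 expn0 expr0.
  rewrite -[n.+1]/(1 + n)%N wsum_row_mx wsum11 exprS mulr_suml.
  by apply: eq_bigr => c _; rewrite IH.
elim: a => [|a IH].
  rewrite mul0n /wsum (eq_bigr (fun=> 1)) => [|Y _]; last first.
    by rewrite /mxweight big_ord0 mul1r.
  by rewrite big_const iter_addr addr0 card_mx mul0n expn0 expr0.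
rewrite -[a.+1]/(1 + a)%N wsum_col_mx IH mulnDl mul1n exprD -(row1 b).
by rewrite /wsum mulr_suml; apply: eq_bigr => Y _; rewrite mulr1.
Qed.

Lemma wsumZ a b (k : R) (G : 'M[F]_(a, b) -> R) :
  wsum (fun Y => k * G Y) = k * wsum G.
Proof. by rewrite /wsum mulr_sumr; apply: eq_bigr => Y _; rewrite mulrCA. Qed.

Lemma wsumD a b (G H : 'M[F]_(a, b) -> R) :
  wsum (fun Y => G Y + H Y) = wsum G + wsum H.
Proof. by rewrite /wsum -big_split; apply: eq_bigr => Y _; rewrite mulrDr. Qed.

Lemma wsumB a b (G H : 'M[F]_(a, b) -> R) :
  wsum (fun Y => G Y - H Y) = wsum G - wsum H.
Proof. by rewrite /wsum -sumrB; apply: eq_bigr => Y _; rewrite mulrBr. Qed.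

Lemma wsum_sum a b (I : finType) (Q : pred I) (G : I -> 'M[F]_(a, b) -> R) :
  wsum (fun Y => \sum_(i | Q i) G i Y) = \sum_(i | Q i) wsum (G i).
Proof.
by rewrite /wsum exchange_big; apply: eq_bigr => Y _; rewrite mulr_sumr.
Qed.

Hypothesis g_ge0 : forall c, 0 <= g c.

Lemma mxweight_ge0 a b (Y : 'M[F]_(a, b)) : 0 <= mxweight Y.
Proof. by do 2![apply: prodr_ge0 => ? _]. Qed.

Lemma le_wsum a b (G H : 'M[F]_(a, b) -> R) :
  (forall Y, G Y <= H Y) -> wsum G <= wsum H.
Proof. by move=> GH; apply: ler_sum => Y _; rewrite ler_wpM2l ?mxweight_ge0. Qed.

Lemma wsum_ge0 a b (G : 'M[F]_(a, b) -> R) : (forall Y, 0 <= G Y) -> 0 <= wsum G.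
Proof. by move=> G0; apply: sumr_ge0 => Y _; rewrite mulr_ge0 ?mxweight_ge0. Qed.

Lemma ler_norm_wsum a b (G : 'M[F]_(a, b) -> R) :
  `|wsum G| <= wsum (fun Y => `|G Y|).
Proof.
rewrite /wsum (le_trans (ler_norm_sum _ _ _)) // ler_sum // => Y _.
by rewrite normrM (ger0_norm (mxweight_ge0 _)).
Qed.

Hypothesis g_sum1 : \sum_c g c = 1.

Lemma wsum_cst a b (k : R) : wsum (fun _ : 'M[F]_(a, b) => k) = k.
Proof.
rewrite -[RHS]mulr1 -(expr1n _ (a * b)) -[in RHS]g_sum1 -wsum1 -wsumZ.
by apply: eq_wsum => Y; rewrite mulr1.
Qed.

Lemma wsum_le a b (G : 'M[F]_(a, b) -> R) k : (forall Y, G Y <= k) -> wsum G <= k.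
Proof. by move=> Gk; rewrite -[leRHS](wsum_cst a b); apply: le_wsum. Qed.

End WeightedSums.

Lemma rank_col_mx_rV (F : fieldType) m n (b : 'rV[F]_n) (B : 'M[F]_(m, n)) :
  \rank (col_mx b B) = (~~ (b <= B)%MS + \rank B)%N.
Proof.
rewrite -addsmxE; case: (boolP (b <= B)%MS) => [bB|nbB].
  by rewrite (addsmx_idPr bB).
have b_neq0 : b != 0 by apply: contraNneq nbB => ->; rewrite sub0mx.
have := mxrank_sum_cap b B; rewrite rank_rV b_neq0 => <-.
suff -> : \rank (b :&: B)%MS = 0%N by rewrite addn0.
apply/eqP; apply: contraNT nbB; rewrite -lt0n => cap_gt0.
suff /eqmxP bb : (b :&: B == b)%MS by rewrite -bb capmxSr.
rewrite -(geq_leqif (mxrank_leqif_eq (capmxSl b B))).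
by rewrite rank_rV b_neq0.
Qed.

(** * Linear images of a random row *)

Definition hweight (F : fieldType) n (u : 'cV[F]_n) : nat :=
  (\sum_i (u i ord0 != 0%R))%N.

Lemma hweight_col_mx (F : fieldType) n (a : F) (u : 'cV[F]_n) :
  hweight (col_mx a%:M u) = ((a != 0%R) + hweight u)%N.
Proof.
rewrite /hweight big_split_ord /= big_ord1 col_mxEu mxE eqxx.
by congr (_ + _)%N; apply: eq_bigr => i _; rewrite col_mxEd.
Qed.

Section RowLaw.
Variables (R : realFieldType) (F : finFieldType) (mu : F -> R).
Hypotheses (mu_ge0 : forall c, 0 <= mu c) (mu_sum1 : \sum_c mu c = 1).

Lemma prob_le1 a b (Q : pred 'M[F]_(a, b)) : wsum mu (fun Y => (Q Y)%:R) <= 1.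
Proof. by apply: wsum_le => // Y; rewrite lern1 leq_b1. Qed.

Lemma prob_ge0 a b (Q : pred 'M[F]_(a, b)) : 0 <= wsum mu (fun Y => (Q Y)%:R).
Proof. by apply: wsum_ge0. Qed.

(** Split off the first coordinate [c] of [y] and the first row [b] of [B]. If [b] lies in the row
    space of the remaining rows, the rank is unchanged and the bound is averaged over [c]. Otherwise
    [z - c *: b] lies in that row space for at most one [c], and hitting this value costs a factor
    [rho]. *)
Lemma odlyzko (rho : R) n l (B : 'M[F]_(n, l)) (z : 'rV_l) :
    (forall c, mu c <= rho) ->
  wsum mu (fun y : 'rV_n => (y *m B == z)%:R) <= rho ^+ \rank B.
Proof.
move=> mu_rho; have rho_ge0 : 0 <= rho := le_trans (mu_ge0 0) (mu_rho 0).
elim: n B z => [|n IH] B z.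
  have -> : \rank B = 0%N by apply/eqP; rewrite -leqn0 rank_leq_row.
  exact: prob_le1.
rewrite -[n.+1]/(1 + n)%N in B *; rewrite -(vsubmxK B).
move: (usubmx B) (dsubmx B) => b B'.
rewrite wsum_row_mx wsum11.
have -> : \sum_c mu c * wsum mu (fun Y =>
      (row_mx c%:M Y *m col_mx b B' == z)%:R) =
    \sum_c mu c * wsum mu (fun Y => (Y *m B' == z - c *: b)%:R).
  apply: eq_bigr => c _; congr (_ * _); apply: eq_wsum => Y.
  rewrite mul_row_col mul_scalar_mx; congr (nat_of_bool _)%:R.
  by rewrite [RHS]eq_sym subr_eq addrC eq_sym.
rewrite rank_col_mx_rV; have [bB|nbB] := boolP (b <= B')%MS.
  apply: (@le_trans _ _ (\sum_c mu c * rho ^+ \rank B')).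
    by apply: ler_sum => c _; rewrite ler_wpM2l.
  by rewrite -mulr_suml mu_sum1 mul1r.
rewrite exprD expr1.
have out c : ~~ (z - c *: b <= B')%MS ->
    wsum mu (fun Y => (Y *m B' == z - c *: b)%:R) = 0.
  move=> nzB; rewrite /wsum big1 // => Y _.
  case: eqP => [YB|_]; last by rewrite mulr0.
  by rewrite -YB submxMl in nzB.
have [/existsP[c0 c0P]|/existsPn none] := boolP [exists c, (z - c *: b <= B')%MS].
  rewrite (bigD1 c0) //= big1 ?addr0 => [|c c_neq].
    by rewrite ler_pM ?prob_ge0.
  rewrite out ?mulr0 //; apply: contra nbB => cP.
  have : ((c0 - c) *: b <= B')%MS.
    have -> : (c0 - c) *: b = (z - c *: b) - (z - c0 *: b).
      by rewrite scalerBl opprB addrCA addrAC subrr add0r addrC.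
    by rewrite addmx_sub // eqmx_opp.
  by rewrite eqmx_scale // subr_eq0 eq_sym.
rewrite big1 ?mulr_ge0 ?exprn_ge0 // => c _.
by rewrite out ?mulr0.
Qed.

Definition lin_prob n (u : 'cV[F]_n) (z : F) : R :=
  wsum mu (fun y : 'rV_n => ((y *m u) 0 0 == z)%:R).

Lemma lin_prob_sum1 n (u : 'cV[F]_n) : \sum_z lin_prob u z = 1.
Proof.
rewrite -wsum_sum -[RHS](wsum_cst mu_sum1 1 n); apply: eq_wsum => y.
rewrite (bigD1 ((y *m u) 0 0)) //= eqxx big1 ?addr0 // => z.
by rewrite eq_sym => /negbTE ->.
Qed.

Lemma lin_prob_col_mx n (a : F) (u : 'cV[F]_n) (z : F) :
  lin_prob (col_mx a%:M u) z = \sum_c mu c * lin_prob u (z - c * a).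
Proof.
rewrite /lin_prob wsum_row_mx wsum11; apply: eq_bigr => c _; congr (_ * _).
apply: eq_wsum => y; rewrite mul_row_col -scalar_mxM !mxE eqxx mulr1n; congr (nat_of_bool _)%:R.
by rewrite [RHS]eq_sym subr_eq addrC eq_sym.
Qed.

(** Each nonzero coordinate of [u] convolves the law of the linear form with a dilate of [mu]. The
    deviation from uniform has sum zero, so each such convolution contracts it; a zero coordinate
    leaves the law unchanged. *)
Lemma lin_prob_dist2 (kappa : R) n (u : 'cV[F]_n) :
    (forall (a : F) (f : F -> R), a != 0 -> \sum_z f z = 0 ->
       \sum_z (\sum_c mu c * f (z - c * a)) ^+ 2 <= kappa * \sum_z f z ^+ 2) ->
    0 <= kappa ->
  \sum_z (lin_prob u z - #|F|%:R^-1) ^+ 2 <= kappa ^+ hweight u.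
Proof.
move=> contr kappa_ge0.
have F_gt0 : 0 < #|F|%:R :> R by rewrite ltr0n; apply/card_gt0P; exists 0.
elim: n u => [|n IH] u.
  rewrite /hweight big_ord0 expr0.
  (* With no coordinates, [x ^+ 2 <= x] on the unit interval bounds the squared distance by
     [1 - #|F|%:R^-1]. *)
  apply: (@le_trans _ _ (\sum_z (lin_prob u z - #|F|%:R^-1 * (2 * lin_prob u z - #|F|%:R^-1)))).
    apply: ler_sum => z _.
    have p0 : 0 <= lin_prob u z := prob_ge0 _.
    have p1 : lin_prob u z <= 1 := prob_le1 _.
    nra.
  rewrite sumrB -mulr_sumr sumrB -mulr_sumr lin_prob_sum1 sumr_const.
  have N_gt0 := F_gt0; rewrite -invr_gt0 in N_gt0.
  rewrite -[_^-1 *+ _]mulr_natr (mulVf (lt0r_neq0 F_gt0)); lra.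
rewrite -[n.+1]/(1 + n)%N in u *; rewrite -(vsubmxK u).
move: (usubmx u) (dsubmx u) => a0 {}u; rewrite (mx11_scalar a0).
move: (a0 0 0) => a {a0}; rewrite hweight_col_mx.
have [->|a_neq0] := eqVneq a 0.
  apply: le_trans (IH u); apply: ler_sum => z _.
  rewrite lin_prob_col_mx; under eq_bigr do rewrite mulr0 subr0.
  by rewrite -mulr_suml mu_sum1 mul1r.
rewrite exprD expr1.
pose f z := lin_prob u z - #|F|%:R^-1.
have f_sum0 : \sum_z f z = 0.
  rewrite sumrB lin_prob_sum1 sumr_const -[_^-1 *+ _]mulr_natr.
  by rewrite mulVf ?gt_eqF // subrr.
apply: le_trans (le_trans (contr a f a_neq0 f_sum0) _); last first.
  exact: ler_wpM2l (IH u).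
(* Averaging against [mu] fixes constants, so the new deviation is the convolution of the old
   one. *)
apply: ler_sum => z _; rewrite lin_prob_col_mx le_eqVlt; apply/orP; left.
apply/eqP; congr (_ ^+ 2); rewrite /f; under [RHS]eq_bigr do rewrite mulrBr.
by rewrite sumrB -mulr_suml mu_sum1 mul1r.
Qed.

End RowLaw.

(** * L^2 contraction by convolution on a prime field *)

(** Keep only [s] and [t] in the variance. With deviations [u], [v] from the mean and masses [a],
    [b], one has [a u^2 + b v^2 - a b (u - v)^2 = (a u + b v)^2 + (1 - a - b) (a u^2 + b v^2)],
    which is nonnegative as [a + b <= 1]. *)
Lemma variance_ge (R : realFieldType) (I : finType) (mu x : I -> R) (s t : I) :
    (forall i, 0 <= mu i) -> \sum_i mu i = 1 -> s != t ->
  (\sum_i mu i * x i) ^+ 2 + mu s * mu t * (x s - x t) ^+ 2 <=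
  \sum_i mu i * x i ^+ 2.
Proof.
move=> mu_ge0 mu_sum1 st; set m := \sum_i mu i * x i.
have -> : \sum_i mu i * x i ^+ 2 = m ^+ 2 + \sum_i mu i * (x i - m) ^+ 2.
  have dev k : \sum_i mu i * (x i - k) ^+ 2 =
      \sum_i mu i * x i ^+ 2 - 2 * k * \sum_i mu i * x i + k ^+ 2 * \sum_i mu i.
    rewrite !mulr_sumr -sumrB -big_split; apply: eq_bigr => i _ /=; ring.
  by rewrite dev -/m mu_sum1; ring.
rewrite lerD2l (bigD1 s) //= (bigD1 t) /=; last by rewrite eq_sym.
have : 0 <= \sum_(i | (i != s) && (i != t)) mu i * (x i - m) ^+ 2.
  by apply: sumr_ge0 => i _; rewrite mulr_ge0 ?sqr_ge0.
have : mu s + mu t <= 1.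
  rewrite -mu_sum1 (bigD1 s) //= lerD2l (bigD1 t) /=; last by rewrite eq_sym.
  by rewrite lerDl sumr_ge0.
move: (mu_ge0 s) (mu_ge0 t) (\sum_(i | _) _) => a0 b0 S ab S0.
set u := x s - m; set v := x t - m; have -> : x s - x t = u - v by rewrite /u /v; ring.
have := sqr_ge0 (mu s * u + mu t * v).
have c0 : 0 <= 1 - mu s - mu t by lra.
have := mulr_ge0 (mulr_ge0 a0 (sqr_ge0 u)) c0.
have := mulr_ge0 (mulr_ge0 b0 (sqr_ge0 v)) c0.
nra.
Qed.

(** A Poincaré inequality on the cyclic group: [h] generates it, so any difference [f z - f y]
    telescopes along steps of size [h], while the sum of all squared differences recovers the norm
    of [f] because [f] has sum zero. The constant comes from crude doubling at each step; it only
    matters that it depends on the field alone. *)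
Lemma Fp_poincare (R : realFieldType) p (h : 'F_p) (f : 'F_p -> R) :
    h != 0 -> \sum_y f y = 0 ->
  \sum_y f y ^+ 2 <= 4 ^+ #|'F_p| * \sum_y (f (y + h) - f y) ^+ 2.
Proof.
move=> h_neq0 f_sum0; set D := \sum_y (f (y + h) - f y) ^+ 2.
have D_ge0 : 0 <= D by apply: sumr_ge0 => y _; apply: sqr_ge0.
have shift j : \sum_y (f (y + h *+ j) - f y) ^+ 2 <= 4 ^+ j * D.
  elim: j => [|j IH].
    by rewrite big1 ?mul1r // => y _; rewrite mulr0n addr0 subrr expr0n.
  have le2 : \sum_y (f (y + h *+ j.+1) - f y) ^+ 2 <=
      2 * D + 2 * \sum_y (f (y + h *+ j) - f y) ^+ 2.
    rewrite /D [in leRHS](reindex_inj (addIr (h *+ j))) /= !mulr_sumr -big_split.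
    apply: ler_sum => y _ /=; rewrite mulrSr addrA.
    set u := f (y + h *+ j + h); set v := f (y + h *+ j); set w := f y.
    have := sqr_ge0 (u - v - (v - w)); nra.
  apply: le_trans le2 _; rewrite exprS.
  have [->|j_neq0] := eqVneq j 0%N.
    rewrite big1 => [|y _]; last by rewrite mulr0n addr0 subrr expr0n.
    by rewrite expr0; lra.
  have : 1 <= 4 ^+ j :> R by rewrite exprn_ege1 // ler1n.
  by nra.
have cst (c : R) : #|'F_p|%:R * c = \sum_(z : 'F_p) c.
  by rewrite sumr_const mulr_natl.
have pairs : \sum_y \sum_z (f z - f y) ^+ 2 = 2 * #|'F_p|%:R * \sum_y f y ^+ 2.
  have -> : \sum_y \sum_z (f z - f y) ^+ 2 =
      \sum_y (\sum_z f z ^+ 2 - 2 * f y * \sum_z f z + #|'F_p|%:R * f y ^+ 2).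
    apply: eq_bigr => y _; rewrite mulr_sumr -sumrB cst -big_split.
    by apply: eq_bigr => z _ /=; ring.
  rewrite f_sum0; under eq_bigr do rewrite mulr0 subr0.
  by rewrite big_split -cst -mulr_sumr /=; ring.
have le_pairs : \sum_y \sum_z (f z - f y) ^+ 2 <= #|'F_p|%:R * (4 ^+ #|'F_p| * D).
  have -> : \sum_y \sum_z (f z - f y) ^+ 2 =
      \sum_(c : 'F_p) \sum_y (f (y + h *+ c) - f y) ^+ 2.
    (* Pairs are parametrised by [z = y + c * h], and [c] is read as a natural number of steps. *)
    rewrite exchange_big /= [RHS]exchange_big [LHS]exchange_big; apply: eq_bigr => y _ /=.
    rewrite (reindex_inj (addrI y)) (reindex_inj (mulIf h_neq0)) /=.
    by apply: eq_bigr => c _; rewrite -[in c * h](natr_Zp c) mulr_natl.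
  rewrite cst; apply: ler_sum => c _.
  apply: le_trans (shift c) _; rewrite ler_wpM2r // ler_eXn2l ?ltr1n //.
  by rewrite card_ord ltnW.
have p_gt0 : 0 < #|'F_p|%:R :> R by rewrite ltr0n; apply/card_gt0P; exists 0.
have S_ge0 : 0 <= \sum_y f y ^+ 2 by apply: sumr_ge0 => y _; apply: sqr_ge0.
rewrite -(ler_pM2l p_gt0); apply: le_trans le_pairs; rewrite pairs.
by nra.
Qed.

(** The variance bound, applied pointwise to the translates of [f], gains [mu s * mu t] times the
    energy of [f] for the shift [(t - s) * a]. This shift is nonzero, so the Poincaré inequality
    turns the gain into a fixed fraction of the norm. *)
Lemma Fp_l2_contraction (R : realFieldType) p (mu : 'F_p -> R) (s t : 'F_p) :
    (forall c, 0 <= mu c) -> \sum_c mu c = 1 -> s != t ->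
  forall (a : 'F_p) (f : 'F_p -> R), a != 0 -> \sum_z f z = 0 ->
  \sum_z (\sum_c mu c * f (z - c * a)) ^+ 2 <=
  (1 - mu s * mu t / 4 ^+ #|'F_p|) * \sum_z f z ^+ 2.
Proof.
move=> mu_ge0 mu_sum1 st a f a_neq0 f_sum0.
have h_neq0 : (t - s) * a != 0 by rewrite mulf_neq0 // subr_eq0 eq_sym.
have := Fp_poincare h_neq0 f_sum0.
set D := (X in _ <= _ * X) => poinc.
have tr c : \sum_z f (z - c * a) ^+ 2 = \sum_z f z ^+ 2.
  by rewrite [RHS](reindex_inj (addIr (- (c * a)))).
have DE : \sum_z (f (z - s * a) - f (z - t * a)) ^+ 2 = D.
  rewrite (reindex_inj (addIr (t * a))) /=; apply: eq_bigr => z _.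
  by rewrite addrK -addrA -mulrBl.
apply: (@le_trans _ _ (\sum_z f z ^+ 2 - mu s * mu t * D)).
  have -> : \sum_z f z ^+ 2 - mu s * mu t * D =
      \sum_z (\sum_c mu c * f (z - c * a) ^+ 2 -
              mu s * mu t * (f (z - s * a) - f (z - t * a)) ^+ 2).
    rewrite sumrB exchange_big -mulr_sumr DE; congr (_ - _).
    under eq_bigr => c _ do rewrite -mulr_sumr tr.
    by rewrite -mulr_suml mu_sum1 mul1r.
  apply: ler_sum => z _; rewrite lerBrDr.
  exact: (variance_ge (fun c => f (z - c * a)) mu_ge0 mu_sum1 st).
rewrite mulrBl mul1r lerD2l lerN2 -!mulrA; do 2![rewrite ler_wpM2l //].
by rewrite mulrC ler_pdivrMr ?exprn_gt0 // mulrC.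
Qed.

(** * From linear forms to membership in a subspace *)

Lemma card_left_kernel (F : finFieldType) m n (B : 'M[F]_(m, n)) :
  #|[pred v : 'rV_m | v *m B == 0]| = (#|F| ^ (m - \rank B))%N.
Proof.
rewrite -mxrank_ker -card_rowg; apply: eq_card => v.
by rewrite mem_rowg inE; apply/eqP/sub_kermxP.
Qed.

Section NearlyUniform.
Variables (R : realFieldType) (F : finFieldType) (mu : F -> R).
Hypotheses (mu_ge0 : forall c, 0 <= mu c) (mu_sum1 : \sum_c mu c = 1).
Local Notation N := (#|F|%:R : R).

Lemma card_finField_ge2 : 2 <= N.
Proof. by rewrite ler_nat -cardsT (cardD1 0) (cardD1 1) !inE oner_neq0. Qed.

(** Orthogonality of additive characters without complex numbers: the summand is the sum of the
    nontrivial characters evaluated at the scalar [z *m v^T]. *)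
Lemma sum_orthogonal l (z : 'rV[F]_l) :
  \sum_(v : 'rV_l) (N * ((z *m v^T) 0 0 == 0)%:R - 1) =
  N ^+ l * (N - 1) * (z == 0)%:R.
Proof.
have F_gt0 : (0 < #|F|)%N by apply/card_gt0P; exists 0.
rewrite sumrB -mulr_sumr sumr_const card_mx mul1n.
have -> : \sum_(v : 'rV_l) ((z *m v^T) 0 0 == 0)%:R =
    (#|F| ^ (l - \rank z^T))%:R :> R.
  rewrite -card_left_kernel -sum1_card natr_sum [RHS]big_mkcond /=.
  apply: eq_bigr => v _; rewrite inE -mulrb; congr (_ *+ nat_of_bool _).
  rewrite -[v *m _]trmxK trmx_mul trmxK trmx_eq0.
  rewrite [z *m v^T in RHS]mx11_scalar.
  apply/eqP/eqP => [->|/matrixP/(_ 0 0)]; first by rewrite raddf0.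
  by rewrite !mxE eqxx.
rewrite mxrank_tr rank_rV natrX.
have [_|z_neq0] := eqVneq z 0.
  by rewrite /= subn0 natrX mulr1; ring.
case: l z z_neq0 => [|l] z z_neq0; first by rewrite [z]thinmx0 eqxx in z_neq0.
by rewrite subSS subn0 -exprS natrX mulr0 subrr.
Qed.

(** Expand the indicator of [y *m Q == 0] by [sum_orthogonal]. The [v] with [Q *m v = 0] give
    exactly the main term, and each other [v] contributes at most [N * eta]. After normalisation the
    error is [N / (N - 1) * eta], and [N >= 2]. *)
Lemma prob_mulmx_eq0_near (eta : R) n l (Q : 'M[F]_(n, l)) :
    0 <= eta ->
    (forall v : 'cV_l, Q *m v != 0 -> `|lin_prob mu (Q *m v) 0 - N^-1| <= eta) ->
  `|wsum mu (fun y : 'rV_n => (y *m Q == 0)%:R) - N^-1 ^+ \rank Q| <= 2 * eta.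
Proof.
move=> eta_ge0 near; have N2 := card_finField_ge2; have N0 : N != 0 by lra.
set P := wsum _ _; have rQ : (\rank Q <= l)%N by apply: rank_leq_col.
have PE : N ^+ l * (N - 1) * P =
    \sum_(v : 'rV_l) (N * lin_prob mu (Q *m v^T) 0 - 1).
  rewrite /P -wsumZ; under eq_wsum do rewrite -sum_orthogonal.
  rewrite wsum_sum; apply: eq_bigr => v _; rewrite wsumB wsumZ wsum_cst //.
  by congr (_ * _ - _); apply: eq_wsum => y; rewrite mulmxA.
have ker : \sum_(v : 'rV_l | v *m Q^T == 0) (N * lin_prob mu (Q *m v^T) 0 - 1) =
    N ^+ l * (N - 1) * N^-1 ^+ \rank Q.
  rewrite (eq_bigr (fun=> N - 1)) => [|v /eqP vQ]; last first.
    rewrite -[Q *m _]trmxK trmx_mul trmxK vQ trmx0 /lin_prob.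
    rewrite (@eq_wsum _ _ _ _ _ _ (fun=> 1)) ?wsum_cst ?mulr1 // => y.
    by rewrite mulmx0 mxE eqxx.
  rewrite sumr_const card_left_kernel mxrank_tr -[LHS]mulr_natl natrX.
  by rewrite expfB_cond ?(negbTE N0) // exprVn mulrAC.
have ler_card : `|\sum_(v : 'rV_l | v *m Q^T != 0) (N * lin_prob mu (Q *m v^T) 0 - 1)|
    <= N ^+ l * (N * eta).
  apply: le_trans (ler_norm_sum _ _ _) _.
  have -> : N ^+ l * (N * eta) = \sum_(v : 'rV[F]_l) N * eta.
    by rewrite sumr_const card_mx mul1n -[RHS]mulr_natl natrX.
  rewrite [leRHS](bigID (fun v : 'rV_l => v *m Q^T != 0)) /= -[leLHS]addr0.
  apply: lerD; last by apply: sumr_ge0 => v _; rewrite mulr_ge0.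
  apply: ler_sum => v vQ.
  rewrite -[X in _ - X](mulfV N0) -mulrBr normrM ger0_norm // ler_wpM2l //.
  by apply: near; rewrite -[Q *m _]trmxK trmx_mul trmxK trmx_eq0.
have Nl : 0 < N ^+ l by rewrite exprn_gt0 //; lra.
rewrite (bigID (fun v : 'rV_l => v *m Q^T == 0)) /= ker in PE.
have PB : N ^+ l * (N - 1) * `|P - N^-1 ^+ \rank Q| <= N ^+ l * (N * eta).
  rewrite -(@ger0_norm _ (N ^+ l * (N - 1))); last by rewrite mulr_ge0 ?ltW //; lra.
  by rewrite -normrM mulrBr PE addrAC subrr add0r.
rewrite -mulrA ler_pM2l // in PB.
have N1 : 0 < N - 1 by lra.
by rewrite -(ler_pM2l N1) (le_trans PB) //; nra.
Qed.

End NearlyUniform.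

(** * The corank process *)

Lemma wsum_exchange (R : realFieldType) (F : finFieldType) (g : F -> R)
    a b c d (G : 'M[F]_(a, b) -> 'M[F]_(c, d) -> R) :
  wsum g (fun y => wsum g (G y)) = wsum g (fun Y => wsum g (G^~ Y)).
Proof.
rewrite /wsum; under eq_bigr do rewrite mulr_sumr.
rewrite exchange_big; apply: eq_bigr => Y _ /=; rewrite mulr_sumr.
by apply: eq_bigr => y _; rewrite mulrCA.
Qed.

(** The summand is a product over coordinates, hence an unnormalised [mxweight], and the sum
    factors. *)
Lemma sum_exp_hweight (R : realFieldType) (F : finFieldType) (theta : R) n :
  \sum_(u : 'cV[F]_n) theta ^+ hweight u = (1 + #|F|.-1%:R * theta) ^+ n.
Proof.
pose g (c : F) : R := theta ^+ (c != 0).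
have gE (u : 'cV_n) : theta ^+ hweight u = mxweight g u * 1.
  rewrite mulr1 /mxweight /hweight (big_morph _ (exprD theta) (expr0 theta)).
  by apply: eq_bigr => i _; rewrite big_ord1.
under eq_bigr do rewrite gE.
rewrite -/(wsum g (fun _ => 1)) wsum1 muln1; congr (_ ^+ _).
rewrite (bigD1 0) //= /g eqxx expr0; congr (_ + _).
rewrite (eq_bigr (fun=> theta)) => [|c ->]; last by rewrite expr1.
by rewrite sumr_const cardC1 mulr_natl.
Qed.

(** * Sparse vectors killed by the revealed rows *)

Section SparseKernel.
Variables (R : realFieldType) (F : finFieldType) (mu : F -> R) (rho : R).
Hypotheses (mu_ge0 : forall c, 0 <= mu c) (mu_sum1 : \sum_c mu c = 1).
Hypothesis mu_rho : forall c, mu c <= rho.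

Let rho_ge0 : 0 <= rho := le_trans (mu_ge0 0) (mu_rho 0).

(** The rows are independent, and each is orthogonal to [u] with probability at most [rho], by the
    rank one case of [odlyzko]. *)
Lemma prob_mulmx_cV_eq0 t n (u : 'cV[F]_n) : u != 0 ->
  wsum mu (fun Y : 'M[F]_(t, n) => (Y *m u == 0)%:R) <= rho ^+ t.
Proof.
move=> u_neq0; elim: t => [|t IH]; first exact: prob_le1.
rewrite -[t.+1]/(1 + t)%N wsum_col_mx exprD.
under eq_wsum => y.
  under eq_wsum => Y do rewrite mul_col_mx col_mx_eq0 -mulnb natrM.
  rewrite wsumZ mulrC; over.
rewrite wsumZ mulrC ler_pM ?prob_ge0 //.
apply: le_trans (odlyzko mu_ge0 mu_sum1 u 0 mu_rho) _.
by rewrite -mxrank_tr rank_rV trmx_eq0 u_neq0.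
Qed.

Definition sparse_kernel K t n (Y : 'M[F]_(t, n)) : bool :=
  [exists u : 'cV_n, [&& u != 0, (hweight u < K)%N & Y *m u == 0]].

(* Markov's inequality for [theta ^ hweight u], [theta < 1], replaces a count of
   the vectors [u] of small weight. *)
Lemma prob_sparse_kernel (theta : R) K t n : 0 < theta <= 1 ->
  wsum mu (fun Y : 'M[F]_(t, n) => (sparse_kernel K Y)%:R) <=
  rho ^+ t * ((1 + #|F|.-1%:R * theta) ^+ n / theta ^+ K).
Proof.
move=> /andP[theta_gt0 theta_le1]; have theta_ge0 := ltW theta_gt0.
apply: (@le_trans _ _ (\sum_(u : 'cV[F]_n | (u != 0) && (hweight u < K)%N)
    wsum mu (fun Y : 'M[F]_(t, n) => (Y *m u == 0)%:R))).
  rewrite -wsum_sum; apply: le_wsum => // Y; rewrite /sparse_kernel.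
  case: existsP => [[u /and3P[u0 uK Yu]]|_]; last exact: sumr_ge0.
  by rewrite (bigD1 u) /= ?u0 // Yu lerDl sumr_ge0.
rewrite -sum_exp_hweight mulr_suml mulr_sumr.
rewrite [leRHS](bigID (fun u : 'cV_n => (u != 0) && (hweight u < K)%N)) /=.
rewrite -[leLHS]addr0; apply: lerD; last first.
  by apply: sumr_ge0 => u _; rewrite mulr_ge0 ?divr_ge0 ?exprn_ge0.
apply: ler_sum => u /andP[u0 uK]; apply: le_trans (prob_mulmx_cV_eq0 t u0) _.
rewrite ler_peMr ?exprn_ge0 // ler_pdivlMr ?exprn_gt0 // mul1r.
exact: ler_wiXn2l (ltnW uK).
Qed.

End SparseKernel.

(** * One step of the corank process *)

Section CorankChain.
Variables (R : realFieldType) (F : finFieldType) (mu : F -> R).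
Hypotheses (mu_ge0 : forall c, 0 <= mu c) (mu_sum1 : \sum_c mu c = 1).
Variables (n l : nat) (D : 'M[F]_(n, l)).

(** Here [D] stands for the transpose of the preceding product, and the rows of [Y] are the revealed
    rows of the transposed new factor. *)
Definition corank t (Y : 'M[F]_(t, n)) : nat := (\rank D - \rank (Y *m D))%N.

(** Encodes membership as a linear equation: [y *m escape Y] vanishes exactly when [y *m D] lies in
    the row space of [Y *m D]. *)
Definition escape t (Y : 'M[F]_(t, n)) : 'M[F]_(n, l) := D *m cokermx (Y *m D).

(** Rank-nullity for the cokernel map restricted to the row space of [D], where its kernel is the
    row space of [Y *m D]. *)
Lemma rank_escape t (Y : 'M[F]_(t, n)) : \rank (escape Y) = corank Y.
Proof.
apply/eqP; rewrite /corank eq_sym -(eqn_add2r (\rank (Y *m D))).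
rewrite subnK ?mxrankM_maxr // -{1}(mxrank_mul_ker D (cokermx (Y *m D))) eqn_add2l.
rewrite eqn_leq !mxrankS //; last by rewrite submxE -sub_kermx capmxSr.
by rewrite sub_capmx submxMl sub_kermx mulmx_coker eqxx.
Qed.

Lemma rank_col_mxM t (y : 'rV[F]_n) (Y : 'M[F]_(t, n)) :
  \rank (col_mx y Y *m D) = ((y *m escape Y != 0%R) + \rank (Y *m D))%N.
Proof. by rewrite mul_col_mx rank_col_mx_rV submxE -mulmxA. Qed.

Lemma corank_col_mx t (y : 'rV[F]_n) (Y : 'M[F]_(t, n)) :
  corank (col_mx y Y) = (corank Y - (y *m escape Y != 0%R))%N.
Proof. by rewrite /corank rank_col_mxM addnC subnDA. Qed.

Variables (K : nat) (eta : R).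
Hypothesis eta_ge0 : 0 <= eta.
Hypothesis near_uniform : forall u : 'cV[F]_n, (K <= hweight u)%N ->
  `|lin_prob mu u 0 - #|F|%:R^-1| <= eta.

Let q : R := #|F|%:R^-1.

(** Fix [Y] and average over the new row. Every nonzero [escape Y *m v] is killed by [Y]; if [Y] has
    no sparse kernel vector, it has weight at least [K], so the new row leaves the corank unchanged
    with probability within [2 * eta] of [q ^+ corank Y]. On the sparse event the error is at most
    one. At corank zero the truncated predecessor is harmless, its coefficient being
    [1 - q ^+ 0 = 0]. *)
Lemma corank_step t (f : nat -> R) : (forall c, 0 <= f c <= 1) ->
  `|wsum mu (fun Y : 'M[F]_(1 + t, n) => f (corank Y)) -
    wsum mu (fun Y : 'M[F]_(t, n) =>
      q ^+ corank Y * f (corank Y) + (1 - q ^+ corank Y) * f (corank Y).-1)| <=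
  2 * eta + wsum mu (fun Y : 'M[F]_(t, n) => (sparse_kernel K Y)%:R).
Proof.
move=> f01; rewrite wsum_col_mx wsum_exchange -wsumB.
apply: le_trans (ler_norm_wsum mu_ge0 _) _.
rewrite -[X in X + _](wsum_cst mu_sum1 t n) -wsumD.
apply: le_wsum => // Y; set c := corank Y.
pose P := wsum mu (fun y : 'rV_n => (y *m escape Y == 0)%:R).
have -> : wsum mu (fun y : 'rV_n => f (corank (col_mx y Y))) = P * f c + (1 - P) * f c.-1.
  have -> : P * f c + (1 - P) * f c.-1 = wsum mu (fun y : 'rV_n =>
      f c.-1 + (f c - f c.-1) * (y *m escape Y == 0)%:R).
    by rewrite wsumD wsumZ wsum_cst // -/P; ring.
  apply: eq_wsum => y; rewrite corank_col_mx -/c.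
  by case: eqP => _; rewrite ?subn0 ?subn1 ?mulr1 ?mulr0 ?addr0 // addrC subrK.
have -> : P * f c + (1 - P) * f c.-1 - (q ^+ c * f c + (1 - q ^+ c) * f c.-1) =
    (P - q ^+ c) * (f c - f c.-1) by ring.
have df : `|f c - f c.-1| <= 1.
  have /andP[a0 a1] := f01 c; have /andP[b0 b1] := f01 c.-1.
  by rewrite ler_norml; apply/andP; split; lra.
rewrite normrM; apply: (@le_trans _ _ (`|P - q ^+ c|)); first by rewrite ler_piMr.
case: (boolP (sparse_kernel K Y)) => [_|good].
  have P01 : 0 <= P <= 1 by rewrite prob_ge0 // prob_le1.
  have q01 : 0 <= q ^+ c <= 1.
    have F_gt0 : (0 < #|F|)%N by apply/card_gt0P; exists 0.
    by rewrite exprn_ge0 ?exprn_ile1 ?invr_ge0 // invf_le1 ?ltr0n ?ler1n.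
  apply: (@le_trans _ _ 1); last by rewrite lerDr mulr_ge0.
  by rewrite ler_norml; apply/andP; split; lra.
rewrite addr0 /c -rank_escape; apply: prob_mulmx_eq0_near => // v v_neq0.
apply: near_uniform; rewrite leqNgt; apply: contra good => vK.
apply/existsP; exists (escape Y *m v); rewrite v_neq0 vK /=.
by rewrite mulmxA (mulmxA Y) mulmx_coker mul0mx.
Qed.

End CorankChain.

(* Probability that the chain moving from [c] to [c.-1] with probability
   [1 - q ^+ c], and staying put otherwise, goes from [c] to [r] in [j] steps. *)
Fixpoint ideal_chain (R : realFieldType) (q : R) (r j c : nat) : R :=
  if j is j'.+1 then
    q ^+ c * ideal_chain q r j' c + (1 - q ^+ c) * ideal_chain q r j' c.-1
  else (c == r)%:R.

Lemma ideal_chain01 (R : realFieldType) (q : R) r j c :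
  0 <= q <= 1 -> 0 <= ideal_chain q r j c <= 1.
Proof.
move=> /andP[q0 q1]; elim: j c => [|j IH] c /=; first by rewrite ler0n lern1 leq_b1.
have /andP[a0 a1] := IH c; have /andP[b0 b1] := IH c.-1.
have c0 : 0 <= q ^+ c by rewrite exprn_ge0.
have c1 : q ^+ c <= 1 by rewrite exprn_ile1.
by apply/andP; split; nra.
Qed.

(** * Comparison of the corank with the ideal chain *)

Section CorankLaw.
Variables (R : realFieldType) (F : finFieldType) (mu : F -> R).
Hypotheses (mu_ge0 : forall c, 0 <= mu c) (mu_sum1 : \sum_c mu c = 1).
Variables (n l : nat) (D : 'M[F]_(n, l)).
Variable rho : R.
Hypothesis mu_rho : forall c, mu c <= rho.
Hypothesis rho_lt1 : rho < 1.

Let rho_ge0 : 0 <= rho := le_trans (mu_ge0 0) (mu_rho 0).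
Let q : R := #|F|%:R^-1.

Let q01 : 0 <= q <= 1.
Proof.
have F_gt0 : (0 < #|F|)%N by apply/card_gt0P; exists 0.
by rewrite invr_ge0 ler0n invf_le1 ?ltr0n ?ler1n.
Qed.

(** If the first [t] images are independent, the next one falls in their span with probability at
    most [rho ^+ (\rank D - t)] by [odlyzko]; these failures sum to a geometric series. *)
Lemma prob_row_dependent t : (t <= \rank D)%N ->
  wsum mu (fun Y : 'M[F]_(t, n) => (\rank (Y *m D) != t)%:R) <=
  rho ^+ (\rank D - t) / (1 - rho).
Proof.
have rho1 : 0 < 1 - rho by rewrite subr_gt0.
elim: t => [|t IH] tD.
  rewrite (@eq_wsum _ _ _ _ _ _ (fun=> 0)) => [|Y]; last first.
    by rewrite -lt0n ltnNge rank_leq_row.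
  by rewrite wsum_cst // divr_ge0 ?exprn_ge0 ?(ltW rho1).
rewrite -[t.+1]/(1 + t)%N wsum_col_mx wsum_exchange.
apply: (@le_trans _ _ (wsum mu (fun Y : 'M[F]_(t, n) =>
    (\rank (Y *m D) != t)%:R + rho ^+ (\rank D - t)))).
  apply: le_wsum => // Y; have [Yt|Yt] := eqVneq (\rank (Y *m D)) t; last first.
    by apply: le_trans (prob_le1 mu_ge0 mu_sum1 _) _; rewrite lerDl exprn_ge0.
  rewrite add0r.
  have -> : (\rank D - t)%N = \rank (escape D Y) by rewrite rank_escape /corank Yt.
  rewrite (@eq_wsum _ _ _ _ _ _ (fun y => (y *m escape D Y == 0)%:R)) => [|y].
    exact: odlyzko.
  by rewrite rank_col_mxM Yt eqn_add2r eqb1 negbK.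
rewrite wsumD wsum_cst //; apply: le_trans (lerD (IH (ltnW tD)) (lexx _)) _.
rewrite -(subnSK tD) exprS add1n.
set x := rho ^+ _; have x_ge0 : 0 <= x by rewrite exprn_ge0.
rewrite -(ler_pM2r rho1) mulrDl !mulfVK ?gt_eqF //.
(* What remains is [rho x + rho x (1 - rho) <= x], that is [0 <= x (1 - rho)^2]. *)
have := mulr_ge0 x_ge0 (sqr_ge0 (1 - rho)); nra.
Qed.

Variables (K : nat) (eta beta : R).
Hypothesis eta_ge0 : 0 <= eta.
Hypothesis near_uniform : forall u : 'cV[F]_n, (K <= hweight u)%N ->
  `|lin_prob mu u 0 - #|F|%:R^-1| <= eta.

(** A hybrid argument: after [j + t] true rows, run the ideal chain for the remaining [i] steps.
    Lowering [i] by one costs one application of [corank_step], since the chain values lie between 0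
    and 1. *)
Lemma corank_chain (r t L : nat) :
    (forall t', (t <= t')%N ->
       wsum mu (fun Y : 'M[F]_(t', n) => (sparse_kernel K Y)%:R) <= beta) ->
  `|wsum mu (fun Y : 'M[F]_(L + t, n) => (corank D Y == r)%:R) -
    wsum mu (fun Y : 'M[F]_(t, n) => ideal_chain q r L (corank D Y))| <=
  L%:R * (2 * eta + beta).
Proof.
move=> le_beta; suff main i j : (i + j = L)%N ->
    `|wsum mu (fun Y : 'M[F]_(L + t, n) => (corank D Y == r)%:R) -
      wsum mu (fun Y : 'M[F]_(j + t, n) => ideal_chain q r i (corank D Y))| <=
    i%:R * (2 * eta + beta).
  by have := main L 0%N; rewrite addn0; apply.
elim: i j => [|i IH] j ijL.
  by rewrite add0n in ijL; rewrite ijL mul0r subrr normr0.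
have {}IH := IH j.+1; rewrite addnS -addSn ijL in IH.
rewrite mulrSr mulrDl mul1r.
apply: le_trans (ler_distD (wsum mu (fun Y : 'M[F]_(j.+1 + t, n) =>
  ideal_chain q r i (corank D Y))) _ _) _.
apply: lerD; first exact: IH.
have := @corank_step _ _ mu mu_ge0 mu_sum1 _ _ D K eta eta_ge0 near_uniform
  (j + t) (ideal_chain q r i) (fun c => ideal_chain01 r i c q01).
move/le_trans; apply; rewrite lerD2l; apply: le_beta.
exact: leq_addl.
Qed.

(** Outside an event of geometrically small probability the first [t] images are independent, and
    then the chain starts exactly from [\rank D - t]. *)
Lemma corank_law (r t L : nat) :
    (forall t', (t <= t')%N ->
       wsum mu (fun Y : 'M[F]_(t', n) => (sparse_kernel K Y)%:R) <= beta) ->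
    (t <= \rank D)%N ->
  `|wsum mu (fun Y : 'M[F]_(L + t, n) => (corank D Y == r)%:R) -
    ideal_chain q r L (\rank D - t)| <=
  L%:R * (2 * eta + beta) + rho ^+ (\rank D - t) / (1 - rho).
Proof.
move=> le_beta tD.
apply: le_trans (ler_distD (wsum mu (fun Y : 'M[F]_(t, n) =>
  ideal_chain q r L (corank D Y))) _ _) _.
apply: lerD; first exact: corank_chain.
apply: le_trans (prob_row_dependent tD).
rewrite -[X in _ - X](wsum_cst mu_sum1 t n) -wsumB.
apply: le_trans (ler_norm_wsum mu_ge0 _) _; apply: le_wsum => // Y.
rewrite /corank; case: eqP => [->|_]; first by rewrite subrr normr0.
have /andP[a0 a1] := ideal_chain01 r L (\rank D - \rank (Y *m D)) q01.
have /andP[b0 b1] := ideal_chain01 r L (\rank D - t) q01.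
by rewrite /= ler_norml; apply/andP; split; lra.
Qed.

End CorankLaw.

(** * Solving the corank chain *)

Section QPochhammer.
Variables (R : realType) (q : R).
Hypotheses (q_ge0 : 0 <= q) (q_lt1 : q < 1).
Local Notation Q := (qpochhammer q q).

Lemma qpochhammer0 : Q 0 = 1.
Proof. by rewrite /qpochhammer big_ord0. Qed.

Lemma qpochhammerS n : Q n.+1 = Q n * (1 - q ^+ n.+1).
Proof. by rewrite /qpochhammer big_ord_recr /= exprS. Qed.

Lemma qpochhammer_factor_gt0 n : 0 < 1 - q ^+ n.+1.
Proof. by rewrite subr_gt0 exprn_ilt1. Qed.

Lemma qpochhammer_gt0 n : 0 < Q n.
Proof.
elim: n => [|n IH]; first by rewrite qpochhammer0.
by rewrite qpochhammerS mulr_gt0 ?qpochhammer_factor_gt0.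
Qed.

Lemma qpochhammer_cvg : Q @ \oo --> qpochhammer_inf q q.
Proof.
apply: nonincreasing_is_cvgn.
  apply/nonincreasing_seqP => n; rewrite qpochhammerS ler_piMr //.
    exact: ltW (qpochhammer_gt0 n).
  by rewrite gerBl exprn_ge0.
by exists 0 => _ [n _ <-]; apply: ltW (qpochhammer_gt0 n).
Qed.

Lemma ideal_chain_below r j c : (c < r)%N -> ideal_chain q r j c = 0.
Proof.
elim: j c => [|j IH] c cr /=; first by rewrite ltn_eqF.
by rewrite !IH ?(leq_ltn_trans (leq_pred c)) // !mulr0 addr0.
Qed.

Lemma ideal_chain_above r j c : (j + r < c)%N -> ideal_chain q r j c = 0.
Proof.
elim: j c => [|j IH] c cr /=; first by rewrite gtn_eqF.
by rewrite !IH ?mulr0 ?addr0 //; lia.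
Qed.

(** Here [a] counts the descents and [b] the stays. The descents contribute [Q (r + a) / Q r]; the
    placements of the stays contribute the complete homogeneous symmetric polynomial of degree [b]
    in [q^r, ..., q^(r + a)], which is [q ^+ (r * b)] times a Gaussian binomial. The proof is by
    induction on the number of steps. *)
Lemma ideal_chainE r a b :
  ideal_chain q r (a + b) (r + a) =
  Q (r + a) * Q (a + b) * q ^+ (r * b) / (Q r * Q a * Q b).
Proof.
have Q0 n : Q n != 0 by rewrite gt_eqF ?qpochhammer_gt0.
have f0 n : 1 - q ^+ n.+1 != 0 by rewrite gt_eqF ?qpochhammer_factor_gt0.
move: {2}(a + b)%N (erefl (a + b)%N) => m.
elim: m a b => [|m IH] a b.
  move/eqP; rewrite addn_eq0 => /andP[/eqP -> /eqP ->] /=.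
  rewrite !addn0 eqxx muln0 expr0 !qpochhammer0 !mulr1.
  by rewrite divff.
case: a b => [|a] [|b] //= abm.
- rewrite (_ : (0 + b.+1)%N = b.+1) // addn0.
  have := IH 0%N b; rewrite !add0n addn0 => IHb.
  rewrite /= IHb; last by lia.
  rewrite mulnS exprD qpochhammer0.
  (* A descent below [r] cannot be undone; when [r] is zero the predecessor is again zero, but the
     coefficient vanishes. *)
  have -> : (1 - q ^+ r) * ideal_chain q r b r.-1 = 0.
    case: (r) => [|r']; first by rewrite expr0 subrr mul0r.
    by rewrite ideal_chain_below ?mulr0.
  rewrite qpochhammerS; field.
  by rewrite -?exprS ?f0 ?Q0.
- have := IH a 0%N; rewrite !addn0 => IHa.
  rewrite addnS /= IHa; last by lia.
  rewrite ideal_chain_above; last by lia.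
  rewrite !muln0 !qpochhammerS qpochhammer0; field.
  by rewrite -?exprS ?f0 ?Q0.
- rewrite addSn /= -[(r + a.+1).-1]/(r + a.+1).-1 addnS /= -addnS.
  have -> : (a + b.+1 = a.+1 + b)%N by lia.
  rewrite (IH a.+1 b); last by lia.
  rewrite addSnnS (IH a b.+1); last by lia.
  rewrite addnS [(a + b.+1)%N]addnS !qpochhammerS mulnS.
  (* With [x = q^(a + 1)] and [y = q^(b + 1)], the recursion reduces to the q-Pascal identity
     [1 - x y = x (1 - y) + (1 - x)]. *)
  have -> : q ^+ (a + b).+2 = q ^+ a.+1 * q ^+ b.+1.
    by rewrite -exprD; congr (_ ^+ _); lia.
  have -> : q ^+ (r + a).+1 = q ^+ r * q ^+ a.+1.
    by rewrite -exprD; congr (_ ^+ _); lia.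
  rewrite !(exprD q r (r * b)).
  move: (q ^+ (a + b).+1) => z.
  move: (f0 a) (f0 b); set x := q ^+ a.+1; set y := q ^+ b.+1 => x0 y0.
  field.
  by rewrite x0 y0 !Q0.
Qed.

(** The limiting probability that one more random factor raises the corank from [s] to [s + r]. *)
Definition corank_limit (s r : nat) : R :=
  qpochhammer_inf q q * (q ^+ (r * (s + r)) / (Q r * Q (s + r))).

(** The number [s + r] of stays is fixed while the number [a] of descents grows; in the closed form
    [Q (r + a) / Q a] tends to 1 and [Q (a + (s + r))] to the infinite product. *)
Lemma ideal_chain_cvg s r :
  (fun a => ideal_chain q r (a + (s + r)) (r + a)) @ \oo --> corank_limit s r.
Proof.
have ratio : (fun a => Q (r + a) / Q a) @ \oo --> (1 : R).
  elim: r => [|r' IH].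
    apply: cvg_near_cst; near=> a.
    by rewrite add0n divff // gt_eqF ?qpochhammer_gt0.
  rewrite -[X in _ --> X]mulr1.
  have -> : (fun a => Q (r'.+1 + a) / Q a) =
      (fun a => Q (r' + a) / Q a * (1 - q ^+ (r' + a).+1)).
    by apply/funext => a; rewrite addSn qpochhammerS mulrAC.
  apply: cvgM => //; rewrite -[X in _ --> X]subr0; apply: cvgB; first exact: cvg_cst.
  have -> : (fun a => q ^+ (r' + a).+1) = (fun a => q ^+ (a + r'.+1)).
    by apply/funext => a; rewrite addnS addnC.
  rewrite (cvg_shiftn r'.+1 (fun a => q ^+ a)).
  by apply: cvg_expr; rewrite ger0_norm.
have -> : (fun a => ideal_chain q r (a + (s + r)) (r + a)) = (fun a =>
    Q (r + a) / Q a * (Q (a + (s + r)) * (q ^+ (r * (s + r)) / (Q r * Q (s + r))))).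
  apply/funext => a; rewrite ideal_chainE; field.
  by rewrite !gt_eqF ?qpochhammer_gt0.
rewrite -[X in _ --> X]mul1r; apply: cvgM => //.
apply: cvgM; last exact: cvg_cst.
by rewrite (cvg_shiftn (s + r) Q); apply: qpochhammer_cvg.
Unshelve. all: by end_near.
Qed.

End QPochhammer.

(** * The corank after one more random factor, uniformly in the preceding product *)

Lemma geometric_small (R : realType) (x C e : R) : 0 <= x < 1 -> 0 < e ->
  exists n0, forall n, (n0 <= n)%N -> C * x ^+ n <= e.
Proof.
move=> /andP[x0 x1] e0.
have : (fun n => C * x ^+ n) @ \oo --> C * 0.
  by apply: cvgM; [exact: cvg_cst | apply: cvg_expr; rewrite ger0_norm].
move/cvgrPdist_le => /(_ _ e0)[n0 _ n0P]; exists n0 => n nn0.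
have := n0P n nn0; rewrite /= mulr0 sub0r normrN.
exact/le_trans/ler_norm.
Qed.

Section NonconstantLaw.
Variables (R : realType) (p : nat) (mu : 'F_p -> R).
Hypotheses (mu_ge0 : forall c, 0 <= mu c) (mu_sum1 : \sum_c mu c = 1).
Hypothesis mu_lt1 : forall c, mu c < 1.

Lemma law_sup_lt1 : exists2 rho : R, rho < 1 & forall c, mu c <= rho.
Proof.
exists (\big[Order.max/0]_c mu c); last by move=> c; apply: le_bigmax.
by apply: bigmax_lt.
Qed.

Lemma law_two_atoms : exists s t : 'F_p, [/\ s != t, 0 < mu s & 0 < mu t].
Proof.
have [s s_gt0] : exists s, 0 < mu s.
  apply/existsP; apply: contraT => /existsPn none.
  suff : \sum_c mu c = 0 by rewrite mu_sum1 => /eqP; rewrite oner_eq0.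
  by rewrite big1 // => c _; apply/eqP; rewrite eq_le mu_ge0 leNgt none.
have [t] : exists t, (s != t) && (0 < mu t).
  apply/existsP; apply: contraT => /existsPn none.
  suff : mu s = 1 by move=> s1; have := mu_lt1 s; rewrite s1 ltxx.
  rewrite -mu_sum1 (bigD1 s) //= big1 ?addr0 // => c; rewrite eq_sym => sc.
  by have := none c; rewrite sc /= -leNgt => c0; apply/eqP; rewrite eq_le c0 mu_ge0.
by move=> /andP[st t_gt0]; exists s, t.
Qed.

(** A single deviation is at most the L^2 distance to uniform, which decays geometrically in the
    Hamming weight at a rate independent of [n]. *)
Lemma lin_prob_near_uniform (eta : R) : 0 < eta ->
  exists K, forall n (u : 'cV['F_p]_n), (K <= hweight u)%N ->
    `|lin_prob mu u 0 - #|'F_p|%:R^-1| <= eta.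
Proof.
move=> eta_gt0; have [s [t [st s0 t0]]] := law_two_atoms.
pose kappa := 1 - mu s * mu t / 4 ^+ #|'F_p|.
have pow_gt0 : 0 < 4 ^+ #|'F_p| :> R by rewrite exprn_gt0.
have kappa01 : 0 <= kappa < 1.
  rewrite /kappa subr_ge0 ltrBlDr ltrDl divr_gt0 ?mulr_gt0 // andbT.
  rewrite ler_pdivrMr // mul1r; apply: (@le_trans _ _ 1).
    by rewrite mulr_ile1 // ltW.
  by rewrite exprn_ege1 // ler1n.
have eta2 : 0 < eta ^+ 2 by rewrite exprn_gt0.
have [K KP] := geometric_small 1 kappa01 eta2; exists K => n u Ku.
have := lin_prob_dist2 mu_ge0 mu_sum1 u
  (Fp_l2_contraction mu_ge0 mu_sum1 st) (proj1 (andP kappa01)).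
rewrite (bigD1 0) //=; set d := lin_prob mu u 0 - _ => le_kappa.
rewrite -(@ler_sqr _ `|d|) ?nnegrE ?(ltW eta_gt0) // real_normK ?num_real //.
have := KP _ Ku; rewrite mul1r; apply: le_trans; apply: le_trans le_kappa.
by rewrite lerDl sumr_ge0 // => z _; rewrite sqr_ge0.
Qed.

Local Notation q := (#|'F_p|%:R^-1 : R).

(** The threshold [n0] does not depend on [A], which is what allows iteration over the factors. The
    error is split into thirds: dependence among the first rows, convergence of the ideal chain, and
    the [L] comparison steps. The parameters [L], [K] and [t0] are fixed in this order. *)
Lemma rank_law s r (e : R) : 0 < e -> exists n0, forall n, (n0 <= n)%N ->
  forall A : 'M['F_p]_n, (\rank A + s)%N = n ->
  `|wsum mu (fun M : 'M['F_p]_n => ((\rank (A *m M) + (s + r) == n)%N)%:R) -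
    corank_limit q s r| <= e.
Proof.
move=> e_gt0; have [rho rho_lt1 mu_rho] := law_sup_lt1.
have rho_ge0 : 0 <= rho := le_trans (mu_ge0 0) (mu_rho 0).
have rho1 : 0 < 1 - rho by rewrite subr_gt0.
have rho01 : 0 <= rho < 1 by rewrite rho_ge0.
have e3 : 0 < e / 3 by rewrite divr_gt0.
have N2 : 2 <= #|'F_p|%:R :> R := card_finField_ge2 _ _.
have q_ge0 : 0 <= q by rewrite invr_ge0.
have q_lt1 : q < 1 by rewrite invf_lt1; lra.
have [a1 a1P] := geometric_small (rho ^+ r / (1 - rho)) rho01 e3.
have /cvgrPdist_le /(_ _ e3)[a2 _ a2P] := @ideal_chain_cvg R q q_ge0 q_lt1 s r.
(* With [n = L + t] and [\rank A = n - s], independent first [t] images leave corank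
   [L - s = r + a]; the last [L] steps then make [a] descents and [s + r] stays. *)
pose a := maxn a1 a2; pose L := (a + (s + r))%N.
have err1 : rho ^+ (r + a) / (1 - rho) <= e / 3.
  rewrite exprD mulrAC; apply: a1P; exact: leq_maxl.
have err2 : `|corank_limit q s r - ideal_chain q r L (r + a)| <= e / 3.
  by apply: a2P; apply: leq_maxr.
(* Together with [beta] below this gives [2 * eta + beta = e / (3 * L.+1%:R)]; the successor keeps
   the denominator nonzero. *)
pose eta := e / (12 * L.+1%:R).
have L_gt0 : 0 < L.+1%:R :> R by rewrite ltr0n.
have eta_gt0 : 0 < eta by rewrite divr_gt0 // mulr_gt0.
have [K KP] := lin_prob_near_uniform eta_gt0.
(* This choice gives [g <= 2 - rho], hence [rho * g <= 1 - (1 - rho)^2 < 1]: the decay in the number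
   of rows beats the number of sparse vectors. *)
pose theta : R := (1 - rho) / #|'F_p|%:R.
have theta01 : 0 < theta <= 1.
  rewrite divr_gt0 //=; last by lra.
  by rewrite ler_pdivrMr; lra.
have theta_gt0 : 0 < theta by case/andP: theta01.
pose g : R := 1 + #|'F_p|.-1%:R * theta.
have g_ge0 : 0 <= g by rewrite addr_ge0 ?mulr_ge0 // ltW.
have rho_g01 : 0 <= rho * g < 1.
  rewrite mulr_ge0 //=.
  have : g <= 1 + (1 - rho).
    rewrite lerD2l /theta mulrCA ger_pMr // ler_pdivrMr ?mul1r; last by lra.
    by rewrite ler_nat leq_pred.
  nra.
pose beta := e / (6 * L.+1%:R).
have beta_gt0 : 0 < beta by rewrite divr_gt0 // mulr_gt0.
have [t0 t0P] := geometric_small (g ^+ L / theta ^+ K) rho_g01 beta_gt0.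
exists (L + t0)%N => n nL A rkA.
have [t [nE tt0]] : exists t, n = (L + t)%N /\ (t0 <= t)%N.
  by exists (n - L)%N; rewrite subnKC ?leq_subRL // (leq_trans _ nL) ?leq_addr.
have rkA' : (\rank A = t + (r + a))%N.
  by apply: (@addIn s); rewrite rkA nE /L; clear; lia.
have rkD : (\rank A^T - t = r + a)%N by rewrite mxrank_tr rkA' addKn.
have le_beta t' : (t <= t')%N ->
    wsum mu (fun Y : 'M['F_p]_(t', n) => (sparse_kernel K Y)%:R) <= beta.
  move=> tt'; apply: le_trans (prob_sparse_kernel mu_ge0 mu_sum1 mu_rho K _ _ theta01) _.
  apply: le_trans (t0P t tt0); rewrite -/g.
  (* As [n = L + t], the bound regroups into [g ^+ L / theta ^+ K] times [(rho * g) ^+ t]. *)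
  apply: (@le_trans _ _ (rho ^+ t * (g ^+ n / theta ^+ K))).
    rewrite ler_wpM2r ?divr_ge0 ?exprn_ge0 ?(ltW theta_gt0) //.
    by rewrite ler_wiXn2l // ltW.
  rewrite [in g ^+ n]nE exprD (exprMn t rho g).
  move: (g ^+ L) (g ^+ t) (rho ^+ t) (theta ^+ K)^-1 => x1 x2 x3 x4.
  by rewrite -(_ : x3 * (x1 * x2 * x4) = x1 * x4 * (x3 * x2)) //; ring.
have -> : wsum mu (fun M : 'M['F_p]_n => ((\rank (A *m M) + (s + r) == n)%N)%:R) =
    wsum mu (fun Y : 'M['F_p]_(L + t, n) => (corank A^T Y == r)%:R).
  (* The weight is invariant under transposition, so the columns of [M] may be revealed as the rows
     of [Y]. *)
  rewrite -nE -wsum_tr; apply: eq_wsum => Y; congr (nat_of_bool _)%:R.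
  rewrite -mxrank_tr trmx_mul trmxK /corank.
  have := mxrankM_maxr Y A^T; rewrite mxrank_tr => le_rk.
  move: rkA le_rk; move: (\rank A) (\rank (Y *m A^T)); clear => x y xs yx.
  by apply/eqP/eqP; lia.
have tD : (t <= \rank A^T)%N by rewrite mxrank_tr rkA' leq_addr.
have := corank_law mu_ge0 mu_sum1 mu_rho rho_lt1 (ltW eta_gt0) (KP n) r L le_beta tD.
rewrite rkD => main.
apply: le_trans (ler_distD (ideal_chain q r L (r + a)) _ _) _.
rewrite [X in _ + X]distrC.
have err3 : L%:R * (2 * eta + beta) <= e / 3.
  have -> : 2 * eta + beta = e / (3 * L.+1%:R).
    rewrite /eta /beta; have := lt0r_neq0 L_gt0.
    by move: (L.+1%:R) => x x0; field.
  have -> : L%:R * (e / (3 * L.+1%:R)) = e / 3 * (L%:R / L.+1%:R).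
    by rewrite invfM mulrA [L%:R * e]mulrC -!mulrA [L%:R * _]mulrCA.
  apply: ler_piMr; first exact: ltW.
  by rewrite ler_pdivrMr // mul1r ler_nat.
lra.
Qed.

End NonconstantLaw.

(** * Products of random matrices *)

Section Families.
Variables (R : comNzRingType) (V : finType) (w : V -> R).

Definition cons_ffun k (x : V) (f : {ffun 'I_k -> V}) : {ffun 'I_k.+1 -> V} :=
  [ffun i => oapp f x (unlift ord0 i)].

Lemma cons_ffun0 k x (f : {ffun 'I_k -> V}) : cons_ffun x f ord0 = x.
Proof. by rewrite ffunE unlift_none. Qed.

Lemma cons_ffun_lift k x (f : {ffun 'I_k -> V}) i :
  cons_ffun x f (lift ord0 i) = f i.
Proof. by rewrite ffunE liftK. Qed.

(** The expectation over [k] independent draws of weight [w]; finite functions make the index set of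
    the sum a finite type. *)
Definition family_sum k (G : {ffun 'I_k -> V} -> R) : R :=
  \sum_(f : {ffun 'I_k -> V}) (\prod_i w (f i)) * G f.

Lemma family_sum_recl k (G : {ffun 'I_k.+1 -> V} -> R) :
  family_sum G = \sum_x w x * family_sum (fun f => G (cons_ffun x f)).
Proof.
rewrite /family_sum; under [RHS]eq_bigr do rewrite mulr_sumr.
rewrite pair_big /=.
rewrite (reindex (fun u : V * {ffun 'I_k -> V} => cons_ffun u.1 u.2)) /=.
  apply: eq_bigr => -[x f] _ /=; rewrite big_ord_recl cons_ffun0 -mulrA.
  by congr (_ * (_ * _)); apply: eq_bigr => i _; rewrite cons_ffun_lift.
exists (fun f => (f ord0, [ffun i => f (lift ord0 i)])) => [[x f]|f] _ /=.
  by congr (_, _); [rewrite cons_ffun0 | apply/ffunP => i; rewrite ffunE cons_ffun_lift].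
apply/ffunP => i; have [j ->|->] := unliftP ord0 i.
  by rewrite cons_ffun_lift ffunE.
by rewrite cons_ffun0.
Qed.

Lemma family_sum0 (G : {ffun 'I_0 -> V} -> R) c : (forall f, G f = c) ->
  family_sum G = c.
Proof.
move=> Gc; rewrite /family_sum (eq_bigr (fun=> c)) => [|f _]; last first.
  by rewrite big_ord0 mul1r Gc.
by rewrite sumr_const card_ffun card_ord expn0.
Qed.

End Families.

Lemma partial_sum0 k (r : 'I_k.+1 -> nat) : partial_sum r ord0 = r ord0.
Proof.
rewrite /partial_sum big_mkcond big_ord_recl leqnn big1 => [|j _].
  exact: addn0.
by [].
Qed.

Lemma partial_sum_lift k (r : 'I_k.+1 -> nat) i :
  partial_sum r (lift ord0 i) =
  (r ord0 + partial_sum (fun j => r (lift ord0 j)) i)%N.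
Proof. by rewrite /partial_sum big_mkcond big_ord_recl -big_mkcond. Qed.

Lemma partial_prod0 (F : fieldType) n k (M : 'I_k.+1 -> 'M[F]_n) :
  partial_prod M ord0 = M ord0.
Proof.
rewrite /partial_prod big_mkcond big_ord_recl leqnn big1 => [|j _].
  exact: mulr1.
by [].
Qed.

Lemma partial_prod_lift (F : fieldType) n k (M : 'I_k.+1 -> 'M[F]_n) i :
  partial_prod M (lift ord0 i) =
  M ord0 *m partial_prod (fun j => M (lift ord0 j)) i.
Proof. by rewrite /partial_prod big_mkcond big_ord_recl -big_mkcond. Qed.

(** Over the integers [n - b] may be negative; the additive form keeps the event correct in that
    case and avoids truncated subtraction. *)
Lemma eqz_subn (a b n : nat) : (a%:Z = n%:Z - b%:Z) <-> (a + b == n)%N.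
Proof. by split => [|/eqP]; lia. Qed.

(** An arbitrary initial factor [A], meant to have corank [s], is allowed so that induction on [k]
    can absorb the first matrix into it. *)
Definition coranks_event (F : finFieldType) n k (r : 'I_k -> nat)
    (s : nat) (A : 'M[F]_n) (M : 'I_k -> 'M[F]_n) : bool :=
  [forall i : 'I_k, (\rank (A *m partial_prod M i) + (s + partial_sum r i) == n)%N].

Lemma coranks_event_cons (F : finFieldType) n k (r : 'I_k.+1 -> nat)
    (s : nat) (A : 'M[F]_n) (M0 : 'M[F]_n) (M : {ffun 'I_k -> 'M[F]_n}) :
  coranks_event r s A (cons_ffun M0 M) =
  ((\rank (A *m M0) + (s + r ord0) == n)%N &&
   coranks_event (fun j => r (lift ord0 j)) (s + r ord0) (A *m M0) M).
Proof.
have tailE i : partial_prod (fun j => cons_ffun M0 M (lift ord0 j)) i =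
    partial_prod M i.
  by rewrite /partial_prod; apply: eq_bigr => j _; rewrite cons_ffun_lift.
apply/forallP/andP => [ev|[ev0 /forallP ev] i].
  split; first by have := ev ord0; rewrite partial_prod0 cons_ffun0 partial_sum0.
  apply/forallP => i; have := ev (lift ord0 i).
  by rewrite partial_prod_lift cons_ffun0 tailE partial_sum_lift mulmxA (addnA s).
have [j ->|->] := unliftP ord0 i; last first.
  by rewrite partial_prod0 cons_ffun0 partial_sum0.
have := ev j.
by rewrite partial_prod_lift cons_ffun0 tailE partial_sum_lift mulmxA (addnA s).
Qed.

(** * Limit law of the successive coranks *)

Section ProductLaw.
Variables (R : realType) (p : nat) (mu : 'F_p -> R).
Hypotheses (mu_ge0 : forall c, 0 <= mu c) (mu_sum1 : \sum_c mu c = 1).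
Hypothesis mu_lt1 : forall c, mu c < 1.
Local Notation q := (#|'F_p|%:R^-1 : R).

Definition coranks_limit k (r : 'I_k -> nat) (s : nat) : R :=
  \prod_i (qpochhammer_inf q q * (q ^+ (r i * (s + partial_sum r i)) /
    (qpochhammer q q (r i) * qpochhammer q q (s + partial_sum r i)))).

Lemma coranks_limit_recl k (r : 'I_k.+1 -> nat) s :
  coranks_limit r s = corank_limit q s (r ord0) *
    coranks_limit (fun j => r (lift ord0 j)) (s + r ord0).
Proof.
rewrite /coranks_limit big_ord_recl partial_sum0; congr (_ * _).
by apply: eq_bigr => i _; rewrite partial_sum_lift !addnA.
Qed.

(** Condition on the first matrix: when it produces the required rank, [A *m M] has corank
    [s + r ord0], and the induction hypothesis applies uniformly in that product. Then [rank_law]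
    gives the probability of the first condition. *)
Lemma coranks_law k (r : 'I_k -> nat) s (e : R) : 0 < e ->
  exists n0, forall n, (n0 <= n)%N ->
  forall A : 'M['F_p]_n, (\rank A + s)%N = n ->
  `|family_sum (mxweight mu (a := n) (b := n))
      (fun M : {ffun 'I_k -> 'M['F_p]_n} => (coranks_event r s A M)%:R) -
    coranks_limit r s| <= e.
Proof.
elim: k r s e => [|k IH] r s e e_gt0.
  exists 0%N => n _ A _; rewrite (@family_sum0 _ _ _ _ 1) => [|f]; last first.
    by rewrite /coranks_event; case: forallP => // -[] [].
  by rewrite /coranks_limit big_ord0 subrr normr0 ltW.
pose r' j := r (lift ord0 j); set c := coranks_limit r' (s + r ord0).
have [n1 n1P] := IH r' (s + r ord0)%N (e / 2) (divr_gt0 e_gt0 (ltr0Sn _ 1)).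
(* The error for the first matrix gets multiplied by [c]; adding one covers [c = 0]. *)
have c1 : 0 < 2 * (`|c| + 1) by rewrite mulr_gt0 // ltr_wpDl.
have [n2 n2P] := rank_law mu_ge0 mu_sum1 mu_lt1 s (r ord0) (divr_gt0 e_gt0 c1).
exists (maxn n1 n2) => n; rewrite geq_max => /andP[n1n n2n] A rkA.
rewrite family_sum_recl coranks_limit_recl -/r' -/c.
pose first (M : 'M['F_p]_n) := (\rank (A *m M) + (s + r ord0) == n)%N.
pose rest (M : 'M['F_p]_n) := family_sum (mxweight mu (a := n) (b := n))
  (fun N : {ffun 'I_k -> 'M['F_p]_n} =>
     (coranks_event r' (s + r ord0) (A *m M) N)%:R).
have -> : \sum_M mxweight mu M * family_sum (mxweight mu (a := n) (b := n))
      (fun N : {ffun 'I_k -> 'M['F_p]_n} =>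
         (coranks_event r s A (cons_ffun M N))%:R) =
    wsum mu (fun M : 'M['F_p]_n => (first M)%:R * rest M).
  apply: eq_bigr => M _; congr (_ * _).
  rewrite /rest /family_sum mulr_sumr; apply: eq_bigr => N _.
  by rewrite coranks_event_cons -mulnb natrM mulrCA.
apply: le_trans (ler_distD (wsum mu (fun M : 'M['F_p]_n => (first M)%:R * c)) _ _) _.
have -> : e = e / 2 + e / 2 by field.
apply: lerD.
  rewrite -wsumB; apply: le_trans (ler_norm_wsum mu_ge0 _) _.
  apply: wsum_le => // M; rewrite -mulrBr normrM normr_nat.
  have [/eqP rkAM|_] := boolP (first M); last by rewrite mul0r divr_ge0 // ltW.
  by rewrite mul1r; apply: n1P.
under eq_wsum do rewrite mulrC.
rewrite wsumZ [X in _ - X]mulrC -mulrBr normrM.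
apply: le_trans (ler_wpM2l (normr_ge0 _) (n2P n n2n A rkA)) _.
rewrite mulrA ler_pdivrMr // [leRHS]mulrA divfK ?pnatr_eq0 // mulrC.
by rewrite ler_wpM2l ?lerDl // ltW.
Qed.

End ProductLaw.

(** * From probability spaces to weighted sums *)

Section FiniteLaw.
Variables (R : realType) (d : measure_display) (T : measurableType d).
Variables (P : probability T R).

Lemma prob_finite_law (V : finType) (X : T -> V) (Q : pred V) :
    (forall v, measurable (X @^-1` [set v])) ->
  P [set w | Q (X w)] = (\sum_(v | Q v) P (X @^-1` [set v]))%E.
Proof.
move=> mX; have -> : [set w | Q (X w)] = \bigcup_(v in [set` Q]) (X @^-1` [set v]).
  apply/seteqP; split => w /=; first by move=> QX; exists (X w).
  by move=> [v Qv ->].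
rewrite measure_fin_bigcup //; last first.
  by move=> u v _ _ [w /= [-> ->]].
have -> : [set` Q] = [set` enum Q].
  by apply/seteqP; split => v /=; rewrite mem_enum.
by rewrite -fsbig_seq ?enum_uniq // big_enum.
Qed.

End FiniteLaw.

Section MatrixLaw.
Variables (R : realType) (p : nat) (mu : 'F_p -> R).

(** Both independence hypotheses are applied with the full index set: over the entries they give
    each matrix the law [mxweight mu], and over the matrices they give the product law of the
    family. *)
Lemma prob_matrix_family (d : measure_display) (T : measurableType d)
    (P : probability T R) (n k : nat)
    (M : 'I_k -> {RV P >-> discrete 'M['F_p]_n})
    (Q : pred {ffun 'I_k -> 'M['F_p]_n}) :
    mutually_independent P (fun i => M i : T -> discrete 'M['F_p]_n) ->
    (forall i, mutually_independent P
       (fun (ab : 'I_n * 'I_n) (w : T) =>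
          (M i w : 'M['F_p]_n) ab.1 ab.2 : discrete 'F_p)) ->
    (forall i a b c, P [set w | (M i w : 'M['F_p]_n) a b = c] = (mu c)%:E) ->
  P [set w | Q [ffun i => M i w : 'M['F_p]_n]] =
  (family_sum (mxweight mu (a := n) (b := n)) (fun f => (Q f)%:R))%:E.
Proof.
move=> indep_M indep_entries law.
have law_M i (m : 'M['F_p]_n) : P (M i @^-1` [set m]) = (mxweight mu m)%:E.
  have -> : M i @^-1` [set m] = \bigcap_(ab in [set` [set: 'I_n * 'I_n]%SET])
      ((fun w => (M i w : 'M['F_p]_n) ab.1 ab.2 : discrete 'F_p) @^-1`
        [set m ab.1 ab.2]).
    apply/seteqP; split => w /=.
      by move=> Mw ab _; rewrite -Mw.
    by move=> eqs; apply/matrixP => a b; apply: (eqs (a, b)); rewrite /= inE.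
  rewrite indep_entries //.
  rewrite (eq_bigr (fun ab => (mu (m ab.1 ab.2))%:E)) => [|ab _]; last exact: law.
  rewrite prodEFin /mxweight pair_big /=; congr (_%:E).
  by apply: eq_bigl => ab; rewrite inE.
pose X w : {ffun 'I_k -> 'M['F_p]_n} := [ffun i => M i w : 'M['F_p]_n].
have X_preimage f : X @^-1` [set f] =
    \bigcap_(i in [set` [set: 'I_k]%SET]) (M i @^-1` [set f i]).
  apply/seteqP; split => w /=.
    by move=> <- i _; rewrite /X ffunE.
  by move=> eqs; apply/ffunP => i; rewrite ffunE; apply: eqs; rewrite /= inE.
have law_X f : P (X @^-1` [set f]) = (\prod_i mxweight mu (f i))%:E.
  rewrite X_preimage indep_M //.
  rewrite (eq_bigr (fun i => (mxweight mu (f i))%:E)) => [|i _]; last exact: law_M.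
  rewrite prodEFin; congr (_%:E).
  by apply: eq_bigl => i; rewrite inE.
rewrite -/(X _) (@prob_finite_law _ _ _ P _ X Q) => [|f].
  rewrite (eq_bigr _ (fun f _ => law_X f)) sumEFin /family_sum; congr (_%:E).
  rewrite big_mkcond; apply: eq_bigr => f _.
  by case: (Q f); rewrite ?mulr1 ?mulr0.
rewrite X_preimage; apply: fin_bigcap_measurable => // i _.
exact: measurable_funPTI.
Qed.

End MatrixLaw.

Theorem theorem1p4 (R : realType) (p : nat) (p_prime : prime p)
    (k : nat) (k_ge1 : (1 <= k)%N) (r : 'I_k -> nat)
    (d0 : measure_display) (T0 : measurableType d0) (P0 : probability T0 R)
    (xi : {RV P0 >-> discrete 'F_p})
    (xi_nonconstant : forall c : 'F_p, P0 [set w | xi w = c] != 1%E)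
    (d : nat -> measure_display) (T : forall n : nat, measurableType (d n))
    (P : forall n : nat, probability (T n) R)
    (M : forall n : nat, 'I_k -> {RV (P n) >-> discrete 'M['F_p]_n})
    (M_independent : forall n : nat,
       mutually_independent (P n) (fun i : 'I_k => M n i : T n -> discrete 'M['F_p]_n))
    (entries_independent : forall (n : nat) (i : 'I_k),
       mutually_independent (P n)
         (fun (ab : 'I_n * 'I_n) (w : T n) =>
            (M n i w : 'M['F_p]_n) ab.1 ab.2 : discrete 'F_p))
    (entries_distribution :
       forall (n : nat) (i : 'I_k) (a b : 'I_n) (A : set (discrete 'F_p)),
         P n [set w | A ((M n i w : 'M['F_p]_n) a b)] = distribution P0 xi A) :
  P n [set w | forall i : 'I_k,
         (\rank (partial_prod (fun j : 'I_k => M n j w : 'M['F_p]_n) i))%:Z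
         = n%:Z - (partial_sum r i)%:Z] @[n --> \oo]
  --> (qpochhammer_inf p%:R^-1 p%:R^-1 ^+ k *
       \prod_(i < k)
          (p%:R^-1 ^+ (r i * partial_sum r i) /
           (qpochhammer p%:R^-1 p%:R^-1 (r i) *
            qpochhammer p%:R^-1 p%:R^-1 (partial_sum r i))) : R)%:E.
Proof.
have mxi c : measurable (xi @^-1` [set c]) by apply: measurable_funPTI.
pose mu c : R := fine (P0 (xi @^-1` [set c])).
have muE c : P0 (xi @^-1` [set c]) = (mu c)%:E.
  by rewrite fineK // fin_num_measure.
have mu_ge0 c : 0 <= mu c by rewrite -lee_fin -muE measure_ge0.
have mu_sum1 : \sum_c mu c = 1.
  have := @prob_finite_law _ _ _ P0 _ (xi : T0 -> 'F_p) predT mxi.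
  rewrite (eq_bigr _ (fun c _ => muE c)) sumEFin (_ : [set w | _] = setT).
    by rewrite probability_setT => -[].
  by apply/seteqP; split.
have mu_lt1 c : mu c < 1.
  rewrite lt_neqAle -lee_fin -muE probability_le1 // andbT.
  apply: contraNneq (xi_nonconstant c) => mu1.
  by rewrite -[X in P0 X]/(xi @^-1` [set c]) muE mu1.
(* The process starts from the identity matrix, of corank zero. *)
pose Q n : pred {ffun 'I_k -> 'M['F_p]_n} := coranks_event r 0 1%:M.
have PE n : P n [set w | forall i : 'I_k,
      (\rank (partial_prod (fun j : 'I_k => M n j w : 'M['F_p]_n) i))%:Z
      = n%:Z - (partial_sum r i)%:Z] =
    (family_sum (mxweight mu (a := n) (b := n)) (fun f => (Q n f)%:R))%:E.
  rewrite -(@prob_matrix_family _ _ mu _ _ (P n) n k (M n) (Q n)) //; last first.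
    by move=> i a b c; rewrite -muE; apply: (entries_distribution n i a b [set c]).
  have prodE w i : partial_prod [ffun j => M n j w : 'M['F_p]_n] i =
      partial_prod (fun j => M n j w : 'M['F_p]_n) i.
    by apply: eq_bigr => j _; rewrite ffunE.
  congr (P n _); apply/seteqP; split => w /=; rewrite /Q /coranks_event.
    by move=> ev; apply/forallP => i; rewrite mul1mx add0n prodE -eqz_subn.
  by move/forallP => ev i; have := ev i; rewrite mul1mx add0n prodE -eqz_subn.
under eq_fun do rewrite PE.
have <- : coranks_limit R p r 0 = (qpochhammer_inf p%:R^-1 p%:R^-1 ^+ k *
       \prod_(i < k)
          (p%:R^-1 ^+ (r i * partial_sum r i) /
           (qpochhammer p%:R^-1 p%:R^-1 (r i) *
            qpochhammer p%:R^-1 p%:R^-1 (partial_sum r i))) : R).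
  rewrite /coranks_limit card_Fp // big_split /= prodr_const card_ord.
  by congr (_ * _); apply: eq_bigr => i _; rewrite add0n.
apply: cvg_EFin; first by near=> n.
apply/cvgrPdist_le => e e_gt0.
have [n0 n0P] := coranks_law mu_ge0 mu_sum1 mu_lt1 r 0 e_gt0.
near=> n; rewrite /= distrC; apply: n0P; last by rewrite mxrank1 addn0.
by near: n; exists n0.
Unshelve. all: by end_near.
Qed.
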